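(* For every positive integer $\alpha$, either there are no $(\alpha,0)$-Conolly meta-Fibonacci recursions of the form $R(n)=\sum_{i=1}^k R\big(n-s_i-\sum_{j=1}^{p_i}R(n-a_{ij})\big)$, or there are infinitely many.
   Context: Recursions considered: $R(n)=\sum_{i=1}^k R\big(n-s_i-\sum_{j=1}^{p_i}R(n-a_{ij})\big)$ for $n>c$, with integers $k,p_i,a_{ij}\ge1$, $s_i\ge 0$, and initial values $R(1),\dots,R(c)$. Such a recursion is $(\alpha,0)$-Conolly if for some choice of initial values its solution is well defined for all $n$ (all arguments positive) and is a nondecreasing sequence of positive integers in which every positive integer occurs exactly $\alpha$ times (i.e. the sequence $\lceil n/\alpha\rceil$). *)

(* Defs.v *)
From mathcomp Require Import all_boot all_order all_algebra.
From mathcomp Require Import boolp classical_sets functions cardinality.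
Set Implicit Arguments. Unset Strict Implicit. Unset Printing Implicit Defensive.
Import Order.TTheory GRing.Theory Num.Theory.
Local Open Scope classical_set_scope.
Local Open Scope ring_scope.

(* The recursion
     R(n) = \sum_(i <= k) R (n - s_i - \sum_(j <= p_i) R (n - a_ij))
   is encoded by the list [:: (s_1, [:: a_11; ...; a_1p_1]); ... ] of its
   parameters. The number c of initial values is not part of the recursion.
   The order of the terms is recorded, but only finitely many lists are
   reorderings of a given one, so finiteness is unaffected. *)
Definition recursion := seq (nat * seq nat).

(* k >= 1, and for all i, j: p_i >= 1 and a_ij >= 1. *)
Definition admissible (r : recursion) : bool :=
  (0 < size r)%N &&
  all (fun t => (0 < size t.2)%N && all (fun a => (0 < a)%N) t.2) r.

(* The argument n - s - \sum_j R (n - a_j) of the term t = (s, a). *)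
Definition term_arg (R : int -> int) (t : nat * seq nat) (n : int) : int :=
  n - t.1%:Z - \sum_(a <- t.2) R (n - a%:Z).

(* Sequences are functions on int of which only the values at positive indices
   matter. The entries of [init] are R(1), ..., R(c), so c = size init. *)
Definition solution (r : recursion) (init : seq int) (R : int -> int) : Prop :=
  [/\ forall i : nat, (i < size init)%N -> R i.+1%:Z = init`_i,
      forall n : int, (size init)%:Z < n ->
        forall t, t \in r ->
          (forall a, a \in t.2 -> 0 < n - a%:Z) /\ 0 < term_arg R t n
    & forall n : int, (size init)%:Z < n ->
        R n = \sum_(t <- r) R (term_arg R t n)].

Definition conolly_sequence (alpha : nat) (R : int -> int) : Prop :=
  [/\ forall n : int, 0 < n -> 0 < R n,
      forall m n : int, 0 < m -> m <= n -> R m <= R n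
    & forall v : int, 0 < v ->
        ([set n : int | 0 < n /\ R n = v] #= `I_alpha)%card].

Definition conolly_recursion (alpha : nat) (r : recursion) : Prop :=
  admissible r /\
  exists (init : seq int) (R : int -> int),
    solution r init R /\ conolly_sequence alpha R.

(* Main.v *)
(* If R (n + alpha) = R n + 1, then increasing some s_i by 1 and one a_ij of
   the same term by alpha leaves the argument of that term unchanged, as soon
   as n is large enough for it to be defined. So R, with enough initial values,
   also solves the modified recursion, and this step can be repeated with s_i
   growing each time. *)
Require Import Defs.
From mathcomp Require Import all_boot all_order all_algebra.
From mathcomp Require Import boolp classical_sets functions cardinality.
From mathcomp Require Import zify.
Import Order.TTheory GRing.Theory Num.Theory.
Local Open Scope classical_set_scope.

Lemma card_int_interval (n : int) (m : nat) :
  ([set x : int | (n <= x < n + m%:Z)%R] #= `I_m)%card.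
Proof.
have -> : [set x : int | (n <= x < n + m%:Z)%R] =
    (fun i : nat => (n + i%:Z)%R) @` `I_m.
  apply/seteqP; split=> [x /= x_in|_ [i /= lt_im <-]]; last by lia.
  by exists `|(x - n)%R|%N => /=; lia.
by apply: inj_card_eq => i j _ _ /addrI [].
Qed.

Lemma conolly_shift (alpha : nat) (R : int -> int) (n : int) :
  (0 < alpha)%N -> conolly_sequence alpha R -> (0 < n)%R ->
  R (n + alpha%:Z)%R = (R n + 1)%R.
Proof.
move=> alpha_gt0 [Rpos Rmono Rcard] n_gt0; have Rn_gt0 := Rpos n n_gt0.
apply/eqP; rewrite eq_le; apply/andP; split; rewrite leNgt; apply/negP => lt.
- suff : (`I_alpha #<= `I_alpha.-1)%card by rewrite card_le_II; lia.
  have RnS_gt0 : (0 < R n + 1)%R by lia.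
  rewrite -(card_le_eql (Rcard _ RnS_gt0)).
  rewrite -(card_le_eqr (card_int_interval (n + 1)%R alpha.-1)).
  apply: subset_card_le => m [m_gt0 Rm] /=.
  have [le_mn|lt_nm] := leP m n; first by have := Rmono m n m_gt0 le_mn; lia.
  have [le_nm|lt_mn] := leP (n + alpha%:Z)%R m; last by lia.
  by have := Rmono (n + alpha%:Z)%R m ltac:(lia) le_nm; lia.
- suff : (`I_alpha.+1 #<= `I_alpha)%card by rewrite card_le_II ltnn.
  rewrite -(card_le_eqr (Rcard _ Rn_gt0)).
  rewrite -(card_le_eql (card_int_interval n alpha.+1)).
  apply: subset_card_le => m /= m_in; split; first by lia.
  have := Rmono n m n_gt0 ltac:(lia).
  by have := Rmono m (n + alpha%:Z)%R ltac:(lia) ltac:(lia); lia.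
Qed.

Definition shift_head (alpha : nat) (r : recursion) : recursion :=
  if r is (s, a :: l) :: r' then (s.+1, (a + alpha)%N :: l) :: r' else r.

Lemma term_arg_shift (alpha : nat) (R : int -> int) (s a : nat) (l : seq nat)
    (n : int) :
  (0 < alpha)%N -> conolly_sequence alpha R -> (0 < n - (a + alpha)%:Z)%R ->
  term_arg R (s.+1, (a + alpha)%N :: l) n = term_arg R (s, a :: l) n.
Proof.
move=> alpha_gt0 cR n_gt; rewrite /term_arg /= !big_cons.
have := conolly_shift _ _ _ alpha_gt0 cR n_gt.
have -> : (n - (a + alpha)%:Z + alpha%:Z = n - a%:Z)%R by lia.
by lia.
Qed.

Lemma conolly_shift_head (alpha : nat) (r : recursion) :
  (0 < alpha)%N -> conolly_recursion alpha r ->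
  conolly_recursion alpha (shift_head alpha r).
Proof.
move=> alpha_gt0; case: r => [|[s [|a l]] r] // [adm [init [R [sol cR]]]].
split.
  move: adm; rewrite /admissible /= addn_gt0 alpha_gt0 orbT.
  by move=> /andP[/andP[_ ->] ->].
case: sol => _ pos rec.
exists (mkseq (fun i => R i.+1%:Z%R) (size init + alpha)), R; split => //.
have arg_gt0 n : ((size init + alpha)%:Z < n)%R -> (0 < n - (a + alpha)%:Z)%R.
  move=> lt_n; have [] := pos (n - alpha%:Z)%R ltac:(lia) _ (mem_head _ _).
  by move=> /(_ a (mem_head _ _)); lia.
split; rewrite size_mkseq.
- by move=> i lt_i; rewrite nth_mkseq.
- move=> n lt_n t; rewrite inE => /predU1P[->|t_r].
    have [apos argpos] := pos n ltac:(lia) _ (mem_head _ _).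
    rewrite term_arg_shift ?arg_gt0 //; split=> // b /=.
    rewrite inE => /predU1P[->|b_l]; first exact: arg_gt0.
    by apply: apos; rewrite inE b_l orbT.
  by apply: pos; [lia | rewrite inE t_r orbT].
- move=> n lt_n; rewrite rec; last by lia.
  by rewrite !big_cons term_arg_shift ?arg_gt0.
Qed.

Theorem theorem5p2 (alpha : nat) (halpha : (0 < alpha)%N) :
  [set r : recursion | conolly_recursion alpha r] = set0 \/
  infinite_set [set r : recursion | conolly_recursion alpha r].
Proof.
have [->|/set0P[r cr]] := eqVneq [set r | conolly_recursion alpha r] set0.
  by left.
right=> /finite_seqP[rs rsE].
pose head_s (q : recursion) := (head (0%N, [::]) q).1.
have [q [cq]] : exists q, conolly_recursion alpha q /\
    (\max_(q <- rs) head_s q < head_s q)%N.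
  elim: (\max_(q <- rs) head_s q).+1 => [|k [q [cq le_kq]]]; first by exists r.
  exists (shift_head alpha q); split; first exact: conolly_shift_head.
  by case: q cq le_kq => [|[s [|a l]] q] // [].
apply/negP; rewrite -leqNgt; apply: leq_bigmax_seq => //.
by have : [set r | conolly_recursion alpha r] q by []; rewrite rsE.
Qed.
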